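(* For all $0<\epsilon<1$ there exist $n_0\in\mathbb{N}$ and $c>0$ such that the following holds for all $n>n_0$. Let $\alpha\in\left(0,1-\frac{\log\log n}{\log n}\right)$ and denote $\ell=\lceil\alpha n^{\alpha}\rceil$. Then there exists a permutation $\sigma\in S_n$ with $\ell$ cycles such that $$\left|\frac{\chi(\sigma)}{\chi(1)}\right|\ge\chi(1)^{\alpha-\epsilon-1}$$ for every $d<\min\left(\frac{\ell}{200},cn^{\epsilon}\right)$ and every irreducible character $\chi=\chi_\lambda$ of $S_n$ with $\lambda_1=n-d$.
   Context: $S_n$ is the symmetric group on $n$ letters. For a partition $\lambda=(\lambda_1\ge\lambda_2\ge\cdots)$ of $n$, $\chi_\lambda$ is the irreducible complex character of $S_n$ corresponding to $\lambda$, with the standard labelling in which $\chi_{(n)}$ is the trivial character. The number of cycles of a permutation counts all cycles in its disjoint cycle decomposition, including fixed points. The logarithm is natural. *)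

(* Defs.v *)
From mathcomp Require Import all_boot all_order all_algebra.
From mathcomp Require Import fingroup perm mxrepresentation.
From mathcomp Require Import reals exp.
From mathcomp Require Import complex.

Set Implicit Arguments.
Unset Strict Implicit.
Unset Printing Implicit Defensive.

Import Order.TTheory GRing.Theory Num.Theory.

Local Open Scope ring_scope.
Local Open Scope complex_scope.

Definition is_partition (n : nat) (la : seq nat) : bool :=
  [&& sorted geq la, all (fun k => (0 < k)%N) la & sumn la == n].

(* The tableau of shape la is filled row by row, so that i : 'I_n lies in row *)
(* [reshape_index la i] and column [reshape_offset la i].                     *)
Definition row_stab (n : nat) (la : seq nat) : {set 'S_n} :=
  [set s : 'S_n | [forall i, reshape_index la (s i) == reshape_index la i]].

Definition col_stab (n : nat) (la : seq nat) : {set 'S_n} :=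
  [set s : 'S_n | [forall i, reshape_offset la (s i) == reshape_offset la i]].

Section SpechtCharacter.
Variables (R : realType) (n : nat) (la : seq nat).

Local Notation aG := (regular_repr R[i] [set: 'S_n]).

(* An element a of the group algebra is encoded by the matrix of right        *)
(* multiplication by a; [gring_row] recovers the coefficient vector of a.     *)
Definition young_symmetrizer : 'M[R[i]]_#|[set: 'S_n]| :=
  (\sum_(p in row_stab n la) aG p) *m
  (\sum_(q in col_stab n la) (-1) ^+ odd_perm q *: aG q).

(* The Specht module of la, as the right ideal generated by the Young         *)
(* symmetrizer (right, because matrix representations act on row vectors).    *)
Definition specht_repr :=
  submod_repr (cyclic_mx_module aG (gring_row young_symmetrizer)).

Definition chi (s : 'S_n) : R[i] := \tr (specht_repr s).

End SpechtCharacter.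

Arguments chi R {n} la s.

(* Main.v *)
Require Import Defs.
From mathcomp Require Import all_boot all_order all_algebra.
From mathcomp Require Import fingroup perm mxrepresentation.
From mathcomp Require Import reals sequences exp.
From mathcomp Require Import complex.
From mathcomp Require Import ring lra zify.

(** Let e be the Young symmetrizer of la, the signed sum of the products p q
    with p in the row stabilizer R and q in the column stabilizer C, and let
    e(h) be its coefficient at h: the sign of q when h = p q, and 0 outside R C.
    By von Neumann's lemma e e = k e for a scalar k, so left multiplication by
    e is k times a projector onto the Specht module, and the trace of its
    composite with the action of s is k chi(s). Reading that trace on the basis
    of group elements gives ([chi_ratio])
      chi(s) / chi(1) = 1/n! * sum over x of e(x s^-1 x^-1).
    So the normalized character is an average of signs over the placements x of
    the cycles of s^-1 in the diagram.

    The inverse g of s is taken to be one long cycle, with support Y, together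
    with l - 1 fixed points. A placement with Y inside the first row has
    coefficient 1. Put M = l - 1 - d; there are at least (M/n)^d n! such
    placements, since each of the d cells below the first row always has at
    least M of the n spots available ([card_row_placements]).

    The other placements contribute little. Suppose that Y meets exactly the
    set J of the cells below the first row, and that the coefficient is not 0.
    Then the factorization h = p q forces h to send each b in J to another cell
    of J or to a first-row cell in a column of J ([met_succ]), which leaves at
    most 2|J| choices. Once these successors are chosen, the cells of J can be
    moved out of the cycle one by one; each move can be undone, and has at
    least M outcomes ([card_with_succ]). With j = |J|, the number of these
    placements is therefore at most (2j/M)^j times the number of first-row
    placements. Since M >= 16 d, the sum over all nonempty J is at most a
    fraction 1 - 2^-d of it ([sum_contributing]), hence
    chi(s)/chi(1) >= (M/2n)^d ([young_sum_lower]).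

    The exponent alpha - eps - 1 is negative, so what is needed of chi(1) is a
    lower bound. The vectors e x_D, for d-sets D that avoid the first-row cells
    above the lower rows, are linearly independent, and give
    chi(1) >= binomial(n - d, d) >= (n/2d)^d ([degree_lower_bound]). All bounds
    are d-th powers, and it remains to compare their bases
    ([powR_base_bound]). *)

Set Implicit Arguments.
Unset Strict Implicit.
Unset Printing Implicit Defensive.

Import Order.TTheory GRing.Theory Num.Theory.

Local Open Scope ring_scope.

(** * Counting permutations and binomial coefficients *)

(** The elements of A outside D are exchanged, one transposition at a time,
    with those of D outside A. *)
Lemma perm_moving_set (T : finType) (A D : {set T}) : #|A| = #|D| ->
  exists2 s : {perm T}, s @: A = D & forall x, x \notin A :|: D -> s x = x.
Proof.
move: {2}#|A :\: D| (leqnn #|A :\: D|) => k.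
elim: k A => [|k IHk] A leADk cardAD.
  have sAD : A \subset D by rewrite -setD_eq0 -cards_eq0 -leqn0.
  have -> : A = D by apply/eqP; rewrite eqEcard sAD cardAD leqnn.
  exists 1%g => [|x _]; last by rewrite perm1.
  by rewrite -[RHS]imset_id; apply: eq_imset => x; rewrite perm1.
have [AD0|[a]] := set_0Vmem (A :\: D).
  by apply: IHk; rewrite ?AD0 ?cards0.
rewrite inE => /andP[nDa Aa].
have : (0 < #|D :\: A|)%N.
  have : (#|A :\: D| = #|D :\: A|)%N by rewrite !cardsD cardAD setIC.
  by move=> <-; apply/card_gt0P; exists a; rewrite inE nDa.
case/card_gt0P => b; rewrite inE => /andP[nAb Db].
pose t := tperm a b.
have tA x : (x \in t @: A) = (x != a) && ((x == b) || (x \in A)).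
  rewrite -[x](tpermK a b) (mem_imset _ _ perm_inj) tpermK.
  case: tpermP => [->|->|/eqP na /eqP nb].
  - by rewrite (negPf nAb) eqxx.
  - by rewrite Aa eqxx andbT; apply/esym; apply: contraNneq nAb => ->.
  - by rewrite na (negPf nb).
have cardt : #|t @: A| = #|A| by rewrite card_imset //; apply: perm_inj.
case: (IHk (t @: A)) => [||s sA s_fix].
- rewrite -ltnS; apply: leq_trans leADk; apply: proper_card; apply/properP.
  split; last by exists a; rewrite !inE ?nDa // tA eqxx andbF.
  apply/subsetP => x; rewrite !inE tA => /andP[nDx /andP[_ /orP[/eqP e|->]]].
    by rewrite e Db in nDx.
  by rewrite nDx.
- by rewrite cardt.
exists (t * s)%g.
  by rewrite -sA -imset_comp; apply: eq_imset => x; rewrite permM.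
move=> x; rewrite inE negb_or => /andP[nAx nDx].
have [na nb] : a != x /\ b != x.
  by split; [apply: contraNneq nAx => <-|apply: contraNneq nDx => <-].
rewrite permM tpermD // s_fix // inE tA negb_or nDx andbT.
by rewrite (negPf nAx) [x == b]eq_sym (negPf nb) andbF.
Qed.

(** The double count behind both counts of placements. Moving b from x b to a
    spot z of Z x gives a permutation x' of X'; here x' b = z, so x is recovered
    from x' and the old position x b, for which x' leaves at most K values. *)
Lemma swap_count (T : finType) (X X' : {set {perm T}}) (b : T)
    (Z P : {perm T} -> {set T}) (M K : nat) :
  (forall x, x \in X -> (M <= #|Z x|)%N) ->
  (forall x z, x \in X -> z \in Z x -> (x * tperm (x b) z)%g \in X') ->
  (forall x z, x \in X -> z \in Z x -> x b \in P (x * tperm (x b) z)%g) ->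
  (forall x, (#|P x| <= K)%N) ->
  (#|X| * M <= #|X'| * K)%N.
Proof.
move=> leM XX' XP leK.
pose A := [set u : {perm T} * T | (u.1 \in X) && (u.2 \in Z u.1)].
pose A' := [set u : {perm T} * T | (u.1 \in X') && (u.2 \in P u.1)].
pose f (u : {perm T} * T) := ((u.1 * tperm (u.1 b) u.2)%g, u.1 b).
have cardS (W : {set {perm T}}) (V : {perm T} -> {set T}) :
    #|[set u : {perm T} * T | (u.1 \in W) && (u.2 \in V u.1)]| =
    (\sum_(x in W) #|V x|)%N.
  rewrite -sum1_card (eq_bigl (fun u => (u.1 \in W) && (u.2 \in V u.1))).
    by rewrite -(pair_big_dep (mem W) (fun x => mem (V x)) (fun _ _ => 1%N)) /=;
      apply: eq_bigr => x _; rewrite sum1_card.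
  by move=> u; rewrite inE.
have f_inj : injective f.
  move=> [x z] [y w] [] /= e exy.
  have ezw : z = w.
    by move/permP/(_ b): e; rewrite !permM !tpermL.
  by congr (_, _) => //; move: e; rewrite exy ezw => /mulIg.
apply: (@leq_trans #|A|).
  by rewrite cardS -sum_nat_const; apply: leq_sum.
apply: (@leq_trans #|A'|).
  rewrite -(card_imset _ f_inj); apply: subset_leq_card.
  apply/subsetP => _ /imsetP[[x z] + ->]; rewrite !inE /= => /andP[Xx Zz].
  by rewrite XX' ?XP.
by rewrite cardS -sum_nat_const; apply: leq_sum.
Qed.

Lemma leq_card_bigcup (I T : finType) (P : pred I) (A : I -> {set T}) :
  (#|\bigcup_(i | P i) A i| <= \sum_(i | P i) #|A i|)%N.
Proof.
elim/big_rec2: _ => [|i m U _ leU]; first by rewrite cards0.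
by rewrite (leq_trans (leq_card_setU _ _)) // leq_add2l.
Qed.

Lemma bin_le_exp2 n k : ('C(n, k) <= 2 ^ n)%N.
Proof.
have <- : #|powerset [set: 'I_n]| = (2 ^ n)%N.
  by rewrite card_powerset cardsT card_ord.
rewrite -[in 'C(_, _)](card_ord n) -cardsT -cards_draws; apply: subset_leq_card.
by apply/subsetP => A; rewrite !inE => /andP[].
Qed.

(** Compare both sides with the falling factorial of 2j of length j. *)
Lemma expnn_le_fact j : (j ^ j <= 4 ^ j * j`!)%N.
Proof.
apply: (@leq_trans ((2 * j) ^_ j)).
  rewrite ffact_prod -[X in (_ ^ X <= _)%N]card_ord -prod_nat_const.
  by apply: leq_prod => i _; rewrite mul2n -addnn -addnBA ?leq_addr // ltnW.
rewrite -bin_ffact leq_mul2r; apply/orP; right.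
by have := bin_le_exp2 (2 * j) j; rewrite expnM.
Qed.

Lemma ffact_le_exp d j : (d ^_ j <= d ^ j)%N.
Proof.
rewrite ffact_prod -[X in (_ <= _ ^ X)%N]card_ord -prod_nat_const.
by apply: leq_prod => i _; apply: leq_subr.
Qed.

(** Here (2j)^j will count the successors of j cells, and the binomial the
    choices of these cells; the factor 2^j makes the sum over j geometric. *)
Lemma bin_exp_le d j M : (16 * d <= M)%N ->
  ('C(d, j) * (2 ^ j * (2 * j) ^ j) <= M ^ j)%N.
Proof.
move=> leM; apply: (@leq_trans ((16 * d) ^ j)); last first.
  by case: j => // j; rewrite leq_exp2r.
have -> : (('C(d, j) * (2 ^ j * (2 * j) ^ j)) = 4 ^ j * ('C(d, j) * j ^ j))%N.
  by rewrite -[4%N]/(2 * 2)%N !expnMn; ring.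
rewrite -[16%N]/(4 * 4)%N -mulnA !expnMn leq_mul2l; apply/orP; right.
apply: (@leq_trans ('C(d, j) * (4 ^ j * j`!))).
  by rewrite leq_mul2l expnn_le_fact orbT.
by rewrite mulnCA bin_ffact leq_mul2l ffact_le_exp orbT.
Qed.

Lemma bin_lower n d : (4 * d <= n)%N -> (n ^ d <= 'C(n - d, d) * (2 * d) ^ d)%N.
Proof.
move=> le4; apply: (@leq_trans ((2 * (n - d - d)) ^ d)).
  by case: d le4 => // d le4; rewrite leq_exp2r //; lia.
rewrite !expnMn mulnCA leq_mul2l; apply/orP; right.
apply: (@leq_trans ((n - d) ^_ d)).
  rewrite ffact_prod -[X in (_ ^ X <= _)%N]card_ord -prod_nat_const.
  by apply: leq_prod => i _; rewrite leq_sub2l // ltnW.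
rewrite -bin_ffact leq_mul2l -ffactnn ffact_le_exp orbT //.
Qed.

(** * Tableaux and the Young symmetrizer *)

Section Tableau.
Variables (n : nat) (la : seq nat).
Hypothesis la_n : sumn la = n.

Local Notation row i := (reshape_index la (i : 'I_n)).
Local Notation col i := (reshape_offset la (i : 'I_n)).
Local Notation R := (row_stab n la).
Local Notation C := (col_stab n la).

Lemma cell_inj (i j : 'I_n) : row i = row j -> col i = col j -> i = j.
Proof.
move=> rij cij; apply: val_inj.
by rewrite /= -[LHS](reshape_indexK la) rij cij reshape_indexK.
Qed.

Lemma col_lt_row (i : 'I_n) : (col i < nth 0 la (row i))%N.
Proof. by apply: reshape_offsetP; rewrite la_n. Qed.

Lemma cell_exists (i : 'I_n) k : (k < nth 0 la (row i))%N ->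
  {j : 'I_n | row j = row i & col j = k}.
Proof.
move=> lt_k; have := flatten_indexP lt_k; rewrite la_n => lt_f.
exists (Ordinal lt_f); first by rewrite /= flatten_indexKl.
by rewrite /= flatten_indexKr.
Qed.

Lemma row_stabP (p : 'S_n) : reflect (forall i, row (p i) = row i) (p \in R).
Proof. by rewrite inE; apply: (iffP forallP) => h i; apply/eqP. Qed.

Lemma col_stabP (q : 'S_n) : reflect (forall i, col (q i) = col i) (q \in C).
Proof. by rewrite inE; apply: (iffP forallP) => h i; apply/eqP. Qed.

Lemma row_stab_group : group_set R.
Proof.
apply/group_setP; split=> [|p q /row_stabP Rp /row_stabP Rq].
  by apply/row_stabP => i; rewrite perm1.
by apply/row_stabP => i; rewrite permM Rq Rp.
Qed.
Canonical row_stab_groupType := Group row_stab_group.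

Lemma col_stab_group : group_set C.
Proof.
apply/group_setP; split=> [|p q /col_stabP Rp /col_stabP Rq].
  by apply/col_stabP => i; rewrite perm1.
by apply/col_stabP => i; rewrite permM Rq Rp.
Qed.
Canonical col_stab_groupType := Group col_stab_group.

Lemma stab_factor_inj (p p' q q' : 'S_n) :
  p \in R -> p' \in R -> q \in C -> q' \in C ->
  (p * q = p' * q')%g -> p = p' /\ q = q'.
Proof.
move=> Rp Rp' Cq Cq' e.
have e2 : (p'^-1 * p = q' * q^-1)%g.
  by apply: (mulgI p'); apply: (mulIg q); rewrite !mulgA mulgV mul1g e mulgKV.
have /row_stabP Rh : (p'^-1 * p)%g \in R by rewrite groupM ?groupV.
have /col_stabP Ch : (p'^-1 * p)%g \in C by rewrite e2 groupM ?groupV.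
have h1 : (p'^-1 * p = 1)%g.
  by apply/permP => i; rewrite perm1; apply: cell_inj; rewrite ?Rh ?Ch.
have pp : p = p' by rewrite -[p]mul1g -(mulgV p') -mulgA h1 mulg1.
by split=> //; apply: (mulgI p); rewrite e pp.
Qed.

(** Von Neumann's lemma. If cells of one row go to different columns, then the
    column of g i always lies within the row of i; so p can send i to the cell
    of its row in that column, and q = p^-1 g preserves columns. *)
Lemma row_col_factorization (g : 'S_n) :
  (forall i j, row i = row j -> col (g i) = col (g j) -> i = j) ->
  exists2 p, p \in R & exists2 q, q \in C & (g = p * q)%g.
Proof.
move=> g_inj.
have lt_g (i0 : 'I_n) : (col (g i0) < nth 0 la (row i0))%N.
  (* A and A0 have the same size, because g is a bijection. Rows longer than t
     can be shifted so as to inject A into A0, and rows of length at most t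
     lie in A0 entirely: to be onto, phi must reach the cells of the row of
     i0, whose length is t, and these can only come from themselves. *)
  set t := nth 0 la (row i0).
  pose A := [set i : 'I_n | (col (g i) < t)%N].
  pose A0 := [set i : 'I_n | (col i < t)%N].
  pose phi (i : 'I_n) : 'I_n := if (nth 0 la (row i) <= t)%N then i else
    odflt i [pick j : 'I_n | (row j == row i) && (col j == col (g i))].
  have phi_long i : (t < nth 0 la (row i))%N -> i \in A ->
      row (phi i) = row i /\ col (phi i) = col (g i).
    rewrite inE => lt_t lt_g; rewrite /phi leqNgt lt_t /=.
    case: pickP => [j /andP[/eqP-> /eqP->] //|none].
    have [j rj cj] := cell_exists (ltn_trans lt_g lt_t).
    by have := none j; rewrite rj cj !eqxx.
  have row_phi i : i \in A -> row (phi i) = row i.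
    move=> Ai; have [lt_t|ge_t] := ltnP t (nth 0 la (row i)).
      by have [] := phi_long i lt_t Ai.
    by rewrite /phi ge_t.
  have phiA i : i \in A -> phi i \in A0.
    move=> Ai; have [lt_t|ge_t] := ltnP t (nth 0 la (row i)).
      by have [_ c] := phi_long i lt_t Ai; rewrite inE c; rewrite inE in Ai.
    by rewrite inE /phi ge_t (leq_trans (col_lt_row i)).
  have phi_inj : {in A &, injective phi}.
    move=> i j Ai Aj e.
    have rij : row i = row j by rewrite -row_phi // e row_phi.
    have [lt_t|ge_t] := ltnP t (nth 0 la (row i)).
      have [_ ci] := phi_long i lt_t Ai.
      rewrite rij in lt_t; have [_ cj] := phi_long j lt_t Aj.
      by apply: g_inj => //; rewrite -ci -cj e.
    by move: e; rewrite /phi -rij ge_t.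
  have cardA : #|A| = #|A0|.
    have -> : A = g @^-1: A0 by apply/setP => i; rewrite !inE.
    by rewrite (on_card_preimset (onW_bij _ (injF_bij perm_inj))).
  have eqA : phi @: A = A0.
    apply/eqP; rewrite eqEcard card_in_imset // cardA leqnn andbT.
    by apply/subsetP => _ /imsetP[i Ai ->]; apply: phiA.
  have : i0 \in phi @: A by rewrite eqA inE col_lt_row.
  case/imsetP => i Ai ei0.
  have ri : row i = row i0 by rewrite ei0 row_phi.
  by move: ei0 Ai; rewrite /phi ri leqnn inE => <-.
pose pf (i : 'I_n) := s2val (cell_exists (lt_g i)).
have row_pf i : row (pf i) = row i by rewrite /pf; case: cell_exists.
have col_pf i : col (pf i) = col (g i) by rewrite /pf; case: cell_exists.
have pf_inj : injective pf.
  by move=> i j e; apply: g_inj; [rewrite -row_pf e | rewrite -col_pf e].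
exists (perm pf_inj); first by apply/row_stabP => i; rewrite permE.
exists ((perm pf_inj)^-1 * g)%g; last by rewrite mulKVg.
apply/col_stabP => i; rewrite permM -col_pf.
by rewrite -(permE pf_inj) permKV.
Qed.

Definition young_coef (h : 'S_n) : int :=
  \sum_(p in R) \sum_(q in C) (-1) ^+ odd_perm q *+ (p * q == h)%g.

Lemma young_coefM (p q : 'S_n) : p \in R -> q \in C ->
  young_coef (p * q)%g = (-1) ^+ odd_perm q.
Proof.
move=> Rp Cq; rewrite /young_coef (bigD1 p) //= (bigD1 q) //= eqxx.
rewrite big1 ?addr0 => [|q' /andP[Cq' /negPf nq]]; last first.
  by rewrite (inj_eq (mulgI p)) nq.
rewrite big1 ?addr0 // => p' /andP[Rp' np]; rewrite big1 // => q' Cq'.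
case: eqP => // e; have [pp _] := stab_factor_inj Rp' Rp Cq' Cq e.
by rewrite pp eqxx in np.
Qed.

Lemma young_coef_neq0 (h : 'S_n) : young_coef h != 0 ->
  exists2 p, p \in R & exists2 q, q \in C & (h = p * q)%g.
Proof.
move=> nz; case: (boolP [exists p in R, exists q in C, h == p * q]%g).
  case/existsP=> p /andP[Rp /existsP[q /andP[Cq /eqP e]]].
  by exists p => //; exists q.
rewrite negb_exists => /forallP none; case/negP: nz; apply/eqP.
rewrite /young_coef big1 // => p Rp; rewrite big1 // => q Cq.
have := none p; rewrite Rp negb_exists => /forallP /(_ q).
by rewrite Cq /= eq_sym => /negPf->.
Qed.

Lemma young_coef1 : young_coef 1%g = 1.
Proof. by rewrite -[1%g]mulg1 young_coefM ?group1 // odd_perm1. Qed.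

Lemma young_coef_ge (h : 'S_n) : -1 <= young_coef h.
Proof.
have [->//|/young_coef_neq0[p Rp [q Cq ->]]] := eqVneq (young_coef h) 0.
by rewrite young_coefM //; case: odd_perm.
Qed.

Lemma young_coef_row (p z : 'S_n) :
  p \in R -> young_coef (p * z)%g = young_coef z.
Proof.
move=> Rp; rewrite /young_coef (reindex_inj (mulgI p)) /=.
apply: eq_big => [p'|p' _]; first by rewrite groupMl.
by apply: eq_bigr => q _; rewrite -mulgA (inj_eq (mulgI p)).
Qed.

Lemma young_coef_col (q z : 'S_n) :
  q \in C -> young_coef (z * q)%g = (-1) ^+ odd_perm q * young_coef z.
Proof.
move=> Cq; rewrite /young_coef big_distrr; apply: eq_bigr => p _ /=.
rewrite big_distrr (reindex_inj (mulIg q)) /=.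
apply: eq_big => [q'|q' _]; first by rewrite groupMr.
rewrite mulgA (inj_eq (mulIg q)) odd_permM signr_addb.
by rewrite mulrnAr [in RHS]mulrC.
Qed.

(** The invariance determines a up to a scalar: outside R C some transposition t
    of two cells of one row is conjugated by z into C, so that
    a z = a (t z) = - a z. *)
Lemma antisym_coef (a : 'S_n -> int) :
  (forall p z, p \in R -> a (p * z)%g = a z) ->
  (forall q z, q \in C -> a (z * q)%g = (-1) ^+ odd_perm q * a z) ->
  forall z, a z = a 1%g * young_coef z.
Proof.
move=> aR aC z.
have [e0|/young_coef_neq0[p Rp [q Cq ->]]] := eqVneq (young_coef z) 0;
  last first.
  by rewrite young_coefM // aR // -[q in a q]mul1g aC // mulrC.
rewrite e0 mulr0; apply/eqP.
case: (boolP [forall i, forall j, (row i == row j) ==>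
              (col (z i) == col (z j)) ==> (i == j)]).
  move/forallP => z_inj;
  case: (@row_col_factorization z) => [i j rij cij|p Rp [q Cq ez]].
    have := z_inj i => /forallP /(_ j).
    by rewrite rij cij !eqxx => /eqP.
  by move: e0; rewrite ez young_coefM //; case: odd_perm.
case/forallPn => i /forallPn[j].
rewrite !negb_imply => /and3P[/eqP rij /eqP cij nij].
have tR : tperm i j \in R.
  by apply/row_stabP => k; case: tpermP => [->|->|].
have tC : tperm (z i) (z j) \in C.
  by apply/col_stabP => k; case: tpermP => [->|->|].
have : a (z * tperm (z i) (z j))%g = a z.
  by rewrite -tpermJ -(aR _ z tR) conjgE !mulgA mulgV mul1g.
rewrite aC // odd_tperm (inj_eq perm_inj) nij expr1 mulN1r => /eqP.
by rewrite eqNr.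
Qed.

End Tableau.

(** * The normalized character as an average *)

(** Factor L = A B with B a basis of U; then L *m L = k *: L means that
    B *m A = k, and the trace can be computed inside U. *)
Lemma trace_submod_projector (F : fieldType) (gT : finGroupType)
    (G : {group gT}) (n : nat) (rG : mx_representation F G n)
    (U : 'M[F]_n) (Umod : mxmodule rG U) (L : 'M[F]_n) (k : F) (x : gT) :
  (L :=: U)%MS -> L *m L = k *: L -> x \in G ->
  \tr (L *m rG x) = k * \tr (submod_repr Umod x).
Proof.
move=> eqLU LL Gx.
set B := val_submod 1%:M : 'M_(\rank U, n); set A := in_submod U L.
have eL : L = A *m B by rewrite -val_submodE in_submodK ?eqLU.
have BG : B *m rG x = submod_repr Umod x *m B.
  by rewrite -(val_submodJ Umod) // mul1mx -val_submodE.
have AF : row_full A.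
  by rewrite /row_full mxrank_in_submod ?eqLU.
have BA : B *m A = k%:M.
  apply: (row_full_inj AF); apply: (@val_submod_inj _ _ U).
  rewrite val_submodE [RHS]val_submodE mul_mx_scalar -scalemxAl -eL -LL eL.
  by rewrite -/B !mulmxA.
rewrite eL -mulmxA BG mulmxA mxtrace_mulC mulmxA BA.
by rewrite mul_scalar_mx mxtraceZ.
Qed.

Section SpechtTrace.
Variables (R : realType) (n : nat) (la : seq nat).
Hypothesis la_n : sumn la = n.
Local Notation F := R[i]%C.
Local Notation G := [set: 'S_n].
Local Notation aG := (regular_repr F G).
Local Notation e := (@young_coef n la).
Local Notation el := (@enum_val _ (mem G)).

Lemma regular_mxE (x : 'S_n) i j : aG x i j = (el i * x == el j)%g%:R.
Proof.
rewrite /= /regular_mx !mxE eqxx /=; congr (_%:R); congr nat_of_bool.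
by rewrite eq_sym -(inj_eq enum_val_inj) gring_indexK ?inE.
Qed.

Lemma gring_row_young j :
  gring_row (young_symmetrizer R n la) 0 j = (e (el j))%:~R.
Proof.
rewrite /young_symmetrizer mxE mulmx_suml summxE /young_coef raddf_sum /=.
apply: eq_bigr => p _; rewrite mulmx_sumr summxE raddf_sum /=.
apply: eq_bigr => q _; rewrite -scalemxAr mxE -repr_mxM ?inE //.
rewrite regular_mxE gring_indexK ?group1 // mul1g.
case: eqP => _; last by rewrite mulr0 mulr0n.
by rewrite mulr1 mulr1n rmorphXn rmorphN1.
Qed.

(** Left multiplication by the Young symmetrizer, in the basis of group elements
    and acting on row vectors: row i holds the coefficients of e x_i. *)
Definition young_mx : 'M[F]_#|G| := \matrix_(i, j) (e (el j * (el i)^-1)%g)%:~R.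

Lemma young_mx_eq :
  (young_mx :=: cyclic_mx aG (gring_row (young_symmetrizer R n la)))%MS.
Proof.
rewrite /cyclic_mx; apply: eqmx_trans (eqmx_sym (genmxE _)).
suff -> : young_mx = enveloping_algebra_mx aG *m
    lin_mul_row (gring_row (young_symmetrizer R n la)) by [].
apply/row_matrixP => i; rewrite row_mul rowK mul_vec_lin_row.
apply/rowP => j; rewrite 2!mxE [in RHS]mxE.
rewrite (bigD1 (gring_index G (el j * (el i)^-1)%g)) //=.
rewrite gring_row_young regular_mxE gring_indexK ?inE // mulgKV eqxx mulr1.
rewrite big1 ?addr0 // => l nl; rewrite regular_mxE.
case: eqP => [ej|_]; last by rewrite mulr0.
by rewrite -ej mulgK gring_valK eqxx in nl.
Qed.

(** The coefficient form of e e = k e: the convolution square of e has the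
    invariance of [antisym_coef]. *)
Lemma young_coef_conv (z : 'S_n) :
  \sum_y e y * e (z * y^-1)%g = (\sum_y e y * e (y^-1)%g) * e z.
Proof.
pose a (z : 'S_n) : int := \sum_y e y * e (z * y^-1)%g.
rewrite -[LHS]/(a z) (@antisym_coef n la la_n a).
- by congr (_ * _); apply: eq_bigr => y _; rewrite mul1g.
- move=> p w Rp; apply: eq_bigr => y _; congr (_ * _); rewrite -mulgA.
  exact: young_coef_row.
- move=> q w Cq; rewrite /a big_distrr /= (reindex_inj (mulIg q)) /=.
  apply: eq_bigr => y _; rewrite (young_coef_col _ Cq) mulrA; congr (_ * e _).
  by rewrite invMg !mulgA mulgK.
Qed.

Lemma young_mx_sqr : young_mx *m young_mx =
  ((\sum_y e y * e (y^-1)%g)%:~R : F) *: young_mx.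
Proof.
apply/matrixP => i j; rewrite !mxE -intrM.
have := young_coef_conv (el j * (el i)^-1)%g => <-.
rewrite raddf_sum /= [RHS](reindex_inj (mulIg (el i)^-1)%g) /=.
rewrite [RHS](reindex el) /=; last first.
  by exists (gring_index G) => z _; rewrite ?gring_valK ?gring_indexK ?inE.
apply: eq_big => // l _; rewrite !mxE intrM invMg invgK.
by rewrite !mulgA mulgKV.
Qed.

Lemma chi_trace (s : 'S_n) :
  ((\sum_y e y * e (y^-1)%g)%:~R : F) * chi R la s =
  (\sum_(x : 'S_n) e (x * s^-1 * x^-1)%g)%:~R.
Proof.
rewrite -(trace_submod_projector _ young_mx_eq young_mx_sqr) ?inE //.
rewrite raddf_sum /= (reindex el) /=; last first.
  by exists (gring_index G) => z _; rewrite ?gring_valK ?gring_indexK ?inE.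
apply: eq_big => // i _; rewrite mxE.
rewrite (bigD1 (gring_index G (el i * s^-1)%g)) //=.
rewrite regular_mxE mxE !gring_indexK ?inE // mulgKV eqxx mulr1.
rewrite big1 ?addr0 // => l nl; rewrite regular_mxE.
case: eqP => [ej|_]; last by rewrite mulr0.
by rewrite -ej mulgK gring_valK eqxx in nl.
Qed.

(** At s = 1 every term of [chi_trace] is e(1) = 1, so that k chi(1) = n!; in
    particular k is not 0. *)
Lemma chi_ratio (s : 'S_n) :
  chi R la s / chi R la (1%g : 'S_n) =
  (\sum_(x : 'S_n) e (x * s^-1 * x^-1)%g)%:~R / n`!%:R.
Proof.
have h1 : (\sum_(x : 'S_n) e (x * 1^-1 * x^-1)%g)%:~R = n`!%:R :> F.
  rewrite (eq_bigr (fun=> 1)) => [|x _].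
    by rewrite sumr_const -[#|_|]/#|'S_n| card_Sn natz.
  by rewrite invg1 mulg1 mulgV young_coef1.
have nz : n`!%:R != 0 :> F by rewrite pnatr_eq0 -lt0n fact_gt0.
have := chi_trace 1%g; rewrite h1 -chi_trace.
set k : F := _%:~R => e1.
have : k * chi R la (1%g : 'S_n) != 0 by rewrite e1.
rewrite mulf_eq0 negb_or => /andP[kn cn].
by rewrite -e1 invfM mulrACA divff // mul1r.
Qed.

End SpechtTrace.

(** * The degree *)

Section Degree.
Variables (R : realType) (n : nat) (la : seq nat).
Local Notation F := R[i]%C.
Local Notation e := (@young_coef n la).
Local Notation row i := (reshape_index la (i : 'I_n)).
Local Notation col i := (reshape_offset la (i : 'I_n)).

Definition below : {set 'I_n} := [set i : 'I_n | row i != 0%N].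

Definition tops (J : {set 'I_n}) : {set 'I_n} :=
  [set i : 'I_n | (row i == 0%N) && [exists b in J, col b == col i]].

(** A column has only one cell in the first row. *)
Lemma card_tops J : (#|tops J| <= #|J|)%N.
Proof.
have exb i : i \in tops J -> exists2 b, b \in J & col b = col i.
  by rewrite inE => /andP[_ /existsP[b /andP[Jb /eqP]]]; exists b.
pose f i := odflt i [pick b in J | col b == col i].
have fP i : i \in tops J -> f i \in J /\ col (f i) = col i.
  case/exb => b Jb cb; rewrite /f; case: pickP => [c /andP[Jc /eqP] //|].
  by move=> /(_ b); rewrite /= Jb cb eqxx.
have f_inj : {in tops J &, injective f}.
  move=> i j Ti Tj eij.
  apply: (@cell_inj _ la); last first.
    by have [_ <-] := fP _ Ti; rewrite eij; case: (fP _ Tj).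
  by move: Ti Tj; rewrite !inE => /andP[/eqP-> _] /andP[/eqP-> _].
rewrite -(card_in_imset f_inj); apply: subset_leq_card.
by apply/subsetP => _ /imsetP[i Ti ->]; case: (fP _ Ti).
Qed.

Lemma below_factor (p q : 'S_n) b :
  p \in row_stab n la -> q \in col_stab n la -> b \in below ->
  q (p b) \in below :|: tops below.
Proof.
move=> /row_stabP Rp /col_stabP Cq Bb; rewrite in_setU.
have Bpb : p b \in below by rewrite inE Rp; rewrite inE in Bb.
rewrite !inE; case: eqVneq => //= _.
by apply/existsP; exists (p b); rewrite Bpb Cq eqxx.
Qed.

(** For each set D that avoids T = tops below and has as many elements as below,
    let x_D fix T and carry below onto D. If p q x_D = x_D', then a cell b of
    below goes under p q to below or to T; the latter is excluded because
    x_D' b is not in T, so D' is contained in D. Hence the rows and columns of [young_mx] indexed by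
    the x_D form an identity matrix. *)
Lemma degree_lower_bound : exists2 r, chi R la (1%g : 'S_n) = r%:R &
  (r >= 'C(n - #|below|, #|below|))%N.
Proof.
set T := tops below; set d := #|below|.
exists (\rank (young_mx R n la)).
  by rewrite (young_mx_eq R n la) /= -mxtrace1; congr (\tr _); apply: repr_mx1.
pose Ds := [set D : {set 'I_n} | D \subset ~: T & #|D| == d].
have exx D : exists x : 'S_n, (D \in Ds) ==>
    ((x @: below == D) && [forall t in T, x t == t]).
  case: (boolP (D \in Ds)) => [|_]; last by exists 1%g.
  rewrite inE => /andP[sDT /eqP cD].
  have [x xB x_fix] := perm_moving_set (esym cD).
  exists x; rewrite xB eqxx /=; apply/forall_inP => t Tt; apply/eqP/x_fix.
  rewrite inE negb_or; apply/andP; split.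
    by move: Tt; rewrite !inE => /andP[/eqP->].
  by apply: contraL Tt => /(subsetP sDT); rewrite inE.
pose x D := xchoose (exx D).
have xB D : D \in Ds -> x D @: below = D.
  by move=> DsD; have /implyP/(_ DsD)/andP[/eqP] := xchooseP (exx D).
have xT D t : D \in Ds -> t \in T -> x D t = t.
  move=> DsD Tt.
  have /implyP/(_ DsD)/andP[_ /forall_inP] := xchooseP (exx D).
  by move/(_ t Tt)/eqP.
have xdist D D' : D \in Ds -> D' \in Ds -> D != D' ->
    e (x D' * (x D)^-1)%g = 0.
  move=> DsD DsD' nDD'; apply/eqP; apply: contraNT nDD'.
  case/young_coef_neq0 => p Rp [q Cq eh].
  have sub : D' \subset D.
    apply/subsetP => y; rewrite -{1}(xB _ DsD') => /imsetP[b Bb ->].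
    have eb : x D' b = x D (q (p b)).
      by rewrite -!permM mulgA -eh mulgKV.
    have := below_factor Rp Cq Bb; rewrite eb inE => /orP[Bq|Tq].
      by rewrite -{2}(xB _ DsD) imset_f.
    have Tq' : x D' b \in T by rewrite eb xT.
    have : x D' b \in D' by rewrite -{2}(xB _ DsD') imset_f.
    move: DsD'; rewrite inE => /andP[/subsetP sD' _] /sD'.
    by rewrite inE Tq'.
  rewrite eq_sym eqEcard sub /=; move: DsD DsD'.
  by rewrite !inE => /andP[_ /eqP->] /andP[_ /eqP->].
have cardDs : ('C(n - d, d) <= #|Ds|)%N.
  rewrite cards_draws; apply: leq_bin2l.
  rewrite cardsCs setCK card_ord leq_sub2l //; apply: card_tops.
apply: leq_trans cardDs _.
pose G := [set: 'S_n].
pose f (i : 'I_#|Ds|) : 'I_#|G| := gring_index [set: 'S_n] (x (enum_val i)).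
have eI : mxsub f f (young_mx R n la) = 1%:M.
  apply/matrixP => i j; rewrite !mxE !gring_indexK ?inE //.
  case: eqVneq => [->|nij]; first by rewrite mulgV young_coef1.
  by rewrite xdist ?enum_valP // (inj_eq enum_val_inj).
rewrite -(mxrank1 F #|Ds|) -eI -[young_mx R n la]mulmx1 mxsub_mul.
rewrite rowsubE mulmx1.
exact: leq_trans (mxrankM_maxl _ _) (mxrankM_maxr _ _).
Qed.

End Degree.

Lemma card_below n la : sumn la = n -> (#|below n la| + head 0 la = n)%N.
Proof.
move=> la_n.
have le : (head 0 la <= n)%N.
  by rewrite -la_n; case: (la) => //= a l; rewrite leq_addr.
rewrite -[RHS](card_ord n) -(cardsC (below n la)); congr (_ + _)%N.
have -> : ~: below n la = [set widen_ord le i | i : 'I_(head 0 la)].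
  apply/setP => i; rewrite !inE negbK; apply/eqP/imsetP => [ri|[j _ ->]] /=.
    have := @col_lt_row n la la_n i.
    rewrite /reshape_offset ri take0 subn0 nth0 => li.
    by exists (Ordinal li) => //; apply: val_inj.
  have := @flatten_indexKl la 0 j; rewrite /flatten_index take0 nth0.
  by move/(_ (ltn_ord j)).
by rewrite card_imset ?card_ord // => i j /(congr1 val) /= e; apply: val_inj.
Qed.

(** * Placements of a long cycle in the diagram *)

(** The last property is the form in which the transitivity of g on Y is used:
    a nonempty g-stable subset of Y is all of Y. *)
Lemma exists_cycle (n m : nat) : (0 < m <= n)%N ->
  exists (g : 'S_n) (Y : {set 'I_n}),
  [/\ #|Y| = m, #|porbits g| = (n - m).+1,
      forall y, y \in Y -> g y \in Y, forall y, y \notin Y -> g y = y &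
      forall A : {set 'I_n}, A \subset Y -> A != set0 ->
        (forall a, a \in A -> g a \in A) -> A = Y].
Proof.
case: n => [|n] /andP[m0 lemn]; first by rewrite leqNgt m0 in lemn.
pose f (i : 'I_n.+1) : 'I_n.+1 := if (i < m)%N then inord (i.+1 %% m) else i.
have fE i : f i = (if (i < m)%N then i.+1 %% m else i)%N :> nat.
  rewrite /f; case: ifP => // _.
  by rewrite inordK // (leq_trans _ lemn) // ltn_pmod.
have f_lt i : (f i < m)%N = (i < m)%N.
  by rewrite fE; case: ifP => // _; rewrite ltn_pmod.
have f_inj : injective f.
  move=> i j e; apply: val_inj => /=.
  have lij : (i < m)%N = (j < m)%N by rewrite -f_lt e f_lt.
  have : f i = f j :> nat by rewrite e.
  rewrite !fE lij; case: ltnP => // lj /eqP; move: lij; rewrite lj => li.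
  by rewrite -addn1 -[j.+1]addn1 eqn_modDr !modn_small // => /eqP.
pose Y := [set i : 'I_n.+1 | (i < m)%N].
have cY : #|Y| = m.
  have -> : Y = [set widen_ord lemn i | i : 'I_m].
    apply/setP => i; rewrite inE; apply/idP/imsetP => [li|[j _ ->]] /=.
      by exists (Ordinal li) => //; apply: val_inj.
    exact: ltn_ord.
  by rewrite card_imset ?card_ord // => i j /(congr1 val) /= e; apply: val_inj.
pose g := perm f_inj.
have gY y : y \in Y -> g y \in Y by rewrite !inE permE f_lt.
have g_out y : y \notin Y -> g y = y.
  by rewrite inE => /negPf nY; rewrite permE /f nY.
have g_iter (y : 'I_n.+1) : y \in Y -> y = (g ^+ y)%g ord0.
  have gk k : (k < m)%N -> (g ^+ k)%g ord0 = k :> nat.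
    elim: k => [|k IHk] lk; first by rewrite expg0 perm1.
    by rewrite expgSr permM permE fE IHk ?(ltnW lk) // modn_small.
  by rewrite inE => ly; apply: val_inj; rewrite /= gk.
have pY y : y \in Y -> porbit g y = Y.
  move=> Yy; have -> : porbit g y = porbit g ord0.
    by apply/eqP; rewrite eq_porbit_mem (g_iter y Yy) mem_porbit.
  apply/eqP; rewrite eqEsubset; apply/andP; split; apply/subsetP => z.
    case/porbitP => k ->; elim: k => [|k IHk]; last by rewrite expgSr permM gY.
    by rewrite expg0 perm1 inE.
  by move=> Yz; rewrite (g_iter z Yz) mem_porbit.
have p_out y : y \notin Y -> porbit g y = [set y].
  move=> nY; apply/setP => z; rewrite inE; apply/porbitP/eqP => [[k ->]|->].
    by elim: k => [|k IHk]; rewrite ?expg0 ?perm1 // expgSr permM IHk g_out.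
  by exists 0%N; rewrite expg0 perm1.
exists g, Y; split=> //.
- have -> : porbits g = Y |: [set [set y] | y in ~: Y].
    apply/setP => A; rewrite !inE; apply/imsetP/orP.
      case=> y _ ->; have [Yy|nY] := boolP (y \in Y); first by left; rewrite pY.
      by right; rewrite p_out // imset_f // inE.
    case=> [/eqP->|/imsetP[y]]; first by exists ord0; rewrite // pY // inE.
    by rewrite inE => nY ->; exists y; rewrite // p_out.
  rewrite cardsU1 card_imset; last exact: set1_inj.
  rewrite [#|~: Y|]cardsCs setCK card_ord cY.
  suff -> : Y \notin [set [set y] | y in ~: Y] by [].
  apply/negP => /imsetP[y]; rewrite inE => nY eY.
  by move: nY; rewrite eY inE eqxx.
move=> A sAY /set0Pn[a Aa] gA; apply/eqP; rewrite eqEsubset sAY.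
rewrite -(pY a) ?(subsetP sAY) //; apply/subsetP => z /porbitP[k ->].
by elim: k => [|k IHk]; rewrite ?expg0 ?perm1 // expgSr permM gA.
Qed.

Section Placements.
Variables (n : nat) (la : seq nat).
Variables (g : 'S_n) (Y : {set 'I_n}).
Hypothesis gY : forall y, y \in Y -> g y \in Y.
Hypothesis g_out : forall y, y \notin Y -> g y = y.
Hypothesis g_trans : forall A : {set 'I_n}, A \subset Y -> A != set0 ->
  (forall a, a \in A -> g a \in A) -> A = Y.

Local Notation B := (below n la).
Local Notation d := #|B|.
Local Notation M := (n - #|Y| - d)%N.
Local Notation e := (@young_coef n la).
Hypothesis ltdY : (d < #|Y|)%N.

(** A permutation x assigns an entry to each cell, so it places the points of Y
    in the diagram, and [x * g * x^-1] is the cycle that it makes of their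
    cells. *)
Definition row_placements : {set 'S_n} :=
  [set x : 'S_n | [forall b in B, x b \notin Y]].

Definition met (x : 'S_n) : {set 'I_n} := [set b in B | x b \in Y].

(** For b in J, the cell s b is the successor of b in the placed cycle. *)
Definition with_succ (J : {set 'I_n}) (s : {ffun 'I_n -> 'I_n}) : {set 'S_n} :=
  [set x : 'S_n | (met x == J) && [forall b in J, g (x b) == x (s b)]].

(** Where a cell of J can be sent, to leave Y without moving another lower
    cell. *)
Definition free_spots (x : 'S_n) : {set 'I_n} :=
  [set z | (z \notin Y) && (x^-1%g z \notin B)].

Lemma card_free_spots x : (M <= #|free_spots x|)%N.
Proof.
have -> : free_spots x = ~: Y :\: x @: B.
  apply/setP => z; rewrite in_setD in_setC inE andbC.
  by rewrite -{3}[z](permKV x) (mem_imset _ _ perm_inj).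
rewrite cardsD [#|~: Y|]cardsCs setCK card_ord leq_sub2l //.
by rewrite -(card_imset B (@perm_inj _ x)) subset_leq_card ?subsetIr.
Qed.

Lemma swap_free_spot (x : 'S_n) b z c :
  b \in B -> z \in free_spots x -> c \in B -> c != b ->
  (x * tperm (x b) z)%g c = x c.
Proof.
move=> Bb; rewrite inE => /andP[_ nBz] Bc ncb; rewrite permM tpermD //.
  by rewrite (inj_eq perm_inj) eq_sym.
by apply: contraNneq nBz => ->; rewrite permK.
Qed.

(** Induction on J. The set J cannot consist of successors of its own elements,
    for it would then be stable under the cycle, which is longer; so there is b
    in J which is not the successor of an element of J. Moving b to a free spot
    keeps the other successors, and the move is undone by reading the old
    position of b off that of s b. *)
Lemma card_with_succ (J : {set 'I_n}) s : J \subset B ->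
  (#|with_succ J s| * M ^ #|J| <= #|row_placements|)%N.
Proof.
move: {2}#|J| (erefl #|J|) => k; elim: k J => [|k IHk] J cJ sJB.
  rewrite cJ expn0 muln1; apply: subset_leq_card.
  move/eqP: cJ; rewrite cards_eq0 => /eqP->; apply/subsetP => x.
  rewrite !inE => /andP[/eqP m0 _]; apply/forall_inP => b Bb.
  by have := in_set0 b; rewrite -m0 inE Bb /= => ->.
have [->|[x0]] := set_0Vmem (with_succ J s); first by rewrite cards0.
rewrite inE => /andP[/eqP mx0 /forall_inP sx0].
have : ~~ (J \subset s @: J).
  apply/negP => sJs.
  have eJs : J = s @: J.
    by apply/eqP; rewrite eqEcard sJs leq_imset_card.
  have eY : x0 @: J = Y.
    apply: g_trans.
    - by apply/subsetP => _ /imsetP[b + ->]; rewrite -mx0 inE => /andP[].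
    - by rewrite -card_gt0 card_imset ?cJ //; apply: perm_inj.
    move=> _ /imsetP[b Jb ->]; rewrite (eqP (sx0 b Jb)) imset_f // eJs.
    exact: imset_f.
  move: ltdY; rewrite -eY card_imset; last exact: perm_inj.
  by rewrite ltnNge subset_leq_card.
case/subsetPn => b Jb nsb.
have Bb : b \in B by apply: (subsetP sJB).
have cJb : #|J :\ b| = k by move: cJ; rewrite (cardsD1 b) Jb => -[].
have := IHk (J :\ b) cJb (subset_trans (subsetDl _ _) sJB).
rewrite cJb cJ expnS mulnA; apply: leq_trans.
rewrite leq_mul2r; apply/orP; right.
rewrite -[X in (_ <= X)%N]muln1.
pose P (x : 'S_n) := [set g^-1%g (x (s b))].
have sbP x z : x \in with_succ J s -> z \in free_spots x ->
    forall c, c \in J ->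
    g ((x * tperm (x b) z)%g c) = (x * tperm (x b) z)%g (s c) \/ c = b.
  rewrite inE => /andP[/eqP mx /forall_inP sx] fz c Jc.
  have [->|nb] := eqVneq c b; [by right|left].
  rewrite (swap_free_spot Bb fz) ?(subsetP sJB) //.
  rewrite permM tpermD ?(eqP (sx c Jc)) //.
    rewrite (inj_eq perm_inj); apply: contraNneq nsb => ->; exact: imset_f.
  rewrite -(eqP (sx c Jc)); apply: contraTneq fz => ->.
  by rewrite inE gY //; move: Jc; rewrite -mx inE => /andP[].
apply: (@swap_count _ _ _ b free_spots P) => [x _|x z Wx fz|x z Wx fz|x].
- exact: card_free_spots.
- rewrite inE; apply/andP; split.
    apply/eqP/setP => c; rewrite in_setD1 in_set.
    have [->|nb] := eqVneq c b.
      rewrite permM tpermL; move: fz; rewrite inE => /andP[/negPf-> _].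
      by rewrite andbF.
    move: (Wx); rewrite inE => /andP[/eqP<- _] /=; rewrite [RHS]in_set.
    by apply: andb_id2l => Bc; rewrite (swap_free_spot Bb fz).
  apply/forall_inP => c; rewrite !inE => /andP[nb Jc].
  by apply/eqP; case: (sbP x z Wx fz c Jc) => // ec; rewrite ec eqxx in nb.
- move: (Wx); rewrite inE => /andP[/eqP mx /forall_inP sx].
  rewrite inE permM tpermD -?(eqP (sx b Jb)) ?permK //.
    rewrite (eqP (sx b Jb)) (inj_eq perm_inj).
    by apply: contraNneq nsb => ->; exact: imset_f.
  apply: contraTneq fz => ->.
  by rewrite inE gY //; move: Jb; rewrite -mx inE => /andP[].
by rewrite cards1.
Qed.

(** The lower cells are moved out of Y one at a time: there are at least M free
    spots, and at most n old positions. *)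
Lemma card_row_placements : (M ^ d * n`! <= #|row_placements| * n ^ d)%N.
Proof.
pose G (A : {set 'I_n}) := [set x : 'S_n | [forall b in A, x b \notin Y]].
suff : forall A : {set 'I_n}, A \subset B ->
    (M ^ #|A| * n`! <= #|G A| * n ^ #|A|)%N.
  by move=> h; have := h B (subxx _).
move=> A; move: {2}#|A| (erefl #|A|) => k; elim: k A => [|k IHk] A cA sAB.
  rewrite cA !expn0 mul1n muln1 -card_Sn.
  move/eqP: cA; rewrite cards_eq0 => /eqP->; apply: subset_leq_card.
  by apply/subsetP => x _; rewrite inE; apply/forall_inP => b; rewrite inE.
have /card_gt0P[b Ab] : (0 < #|A|)%N by rewrite cA.
have Bb : b \in B by apply: (subsetP sAB).
have cAb : #|A :\ b| = k by move: cA; rewrite (cardsD1 b) Ab => -[].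
have := IHk (A :\ b) cAb (subset_trans (subsetDl _ _) sAB).
rewrite cAb cA !expnS => IH.
rewrite -mulnA (leq_trans (leq_mul (leqnn M) IH)) // !mulnA leq_mul2r.
apply/orP; right; rewrite mulnC.
apply: (@swap_count _ _ _ b free_spots (fun=> setT)) =>
  [x _|x z Gx fz|x z _ _|x].
- exact: card_free_spots.
- rewrite inE; apply/forall_inP => c Ac.
  have [->|nb] := eqVneq c b.
    by rewrite permM tpermL; move: fz; rewrite inE => /andP[].
  rewrite (swap_free_spot Bb fz) ?(subsetP sAB) //.
  by move: Gx; rewrite inE => /forall_inP; apply; rewrite !inE nb.
- by rewrite inE.
by rewrite cardsT card_ord.
Qed.

(** With h = p q, the row of p b is that of b. If p b were outside the cycle, h
    would fix p b, so that p would fix it too: p (p b) has the row and, since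
    q preserves columns, the column of p b. Then p b = b, which is in the cycle.
    So p b is in [met x], and h b lies in its column. *)
Lemma met_succ (x : 'S_n) b : e (x * g * x^-1)%g != 0 -> b \in met x ->
  (x * g * x^-1)%g b \in met x :|: tops la (met x).
Proof.
case/young_coef_neq0 => p Rp [q Cq eh] mb; rewrite eh permM.
have hb c : q (p c) = x^-1%g (g (x c)) by rewrite -!permM -eh mulgA.
have /row_stabP Rp' := Rp; have /col_stabP Cq' := Cq.
have mpb : p b \in met x.
  have Bpb : p b \in B by rewrite inE Rp'; move: mb; rewrite !inE => /andP[].
  rewrite inE Bpb /=; apply: contraLR mb => nY.
  have epb : q (p (p b)) = p b by rewrite hb g_out // permK.
  have e2 : p (p b) = p b.
    by apply: (@cell_inj n la); rewrite ?Rp' // -{2}epb Cq'.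
  by rewrite inE negb_and orbC -(perm_inj e2) nY.
have Yh : x (q (p b)) \in Y.
  by rewrite hb permKV gY //; move: mb; rewrite inE => /andP[].
rewrite in_setU inE Yh andbT !inE; case: eqVneq => //= _.
by apply/existsP; exists (p b); rewrite mpb Cq' eqxx.
Qed.

Definition contributing (J : {set 'I_n}) : {set 'S_n} :=
  [set x : 'S_n | (met x == J) && (e (x * g * x^-1)%g != 0)].

Lemma card_contributing (J : {set 'I_n}) : J \subset B ->
  (#|contributing J| * M ^ #|J| <= (2 * #|J|) ^ #|J| * #|row_placements|)%N.
Proof.
move=> sJB; have [->|[b0 Jb0]] := set_0Vmem J.
  rewrite cards0 !expn0 muln1 mul1n; apply: subset_leq_card.
  apply/subsetP => x; rewrite !inE => /andP[/eqP m0 _].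
  apply/forall_inP => b Bb.
  by have := in_set0 b; rewrite -m0 inE Bb /= => ->.
pose S := [set s : {ffun 'I_n -> 'I_n} | s \in pffun_on b0 J (J :|: tops la J)].
have cS : (#|S| <= (2 * #|J|) ^ #|J|)%N.
  rewrite cardsE card_pffun_on leq_exp2r; last by apply/card_gt0P; exists b0.
  rewrite mul2n -addnn (leq_trans (leq_card_setU _ _)) // leq_add2l.
  exact: card_tops.
apply: (@leq_trans (\sum_(s in S) #|with_succ J s| * M ^ #|J|)); last first.
  apply: (@leq_trans (\sum_(s in S) #|row_placements|)).
    by apply: leq_sum => s _; apply: card_with_succ.
  by rewrite sum_nat_const leq_mul2r cS orbT.
rewrite -big_distrl leq_mul2r; apply/orP; right => /=.
apply: leq_trans (leq_card_bigcup (fun s => s \in S) (with_succ J)).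
apply: subset_leq_card.
apply/subsetP => x; rewrite inE => /andP[/eqP mx ex].
apply/bigcupP.
(* The default value b0 off J makes s a partial function with support in J,
   so that only its values on J are counted. *)
exists [ffun b => if b \in J then (x * g * x^-1)%g b else b0].
  rewrite inE; apply/pffun_onP; split.
    apply/subsetP => b; rewrite inE /= ffunE; case: ifP => //; by rewrite eqxx.
  move=> _ /imageP[b Jb ->]; rewrite ffunE.
  by rewrite Jb -mx; apply: met_succ; rewrite // mx.
rewrite inE mx eqxx /=; apply/forall_inP => b Jb.
by rewrite ffunE Jb !permM permKV.
Qed.

Hypothesis le16M : (16 * d <= M)%N.

(** The placed cycle then preserves rows: its coefficient is that of a product
    p q with q = 1. *)
Lemma young_coef_row_placement x :
  x \in row_placements -> e (x * g * x^-1)%g = 1.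
Proof.
rewrite inE => /forall_inP xg; rewrite -[(_ * _)%g]mulg1 young_coefM ?group1 //.
  by rewrite odd_perm1.
have fixY c : x c \notin Y -> (x * g * x^-1)%g c = c.
  by move=> nY; rewrite !permM g_out // permK.
apply/row_stabP => c; have [Yc|/fixY-> //] := boolP (x c \in Y).
have nB i : x i \in Y -> reshape_index la i = 0%N.
  by move=> Yi; apply/eqP; apply: contraTT Yi => ni; apply: xg; rewrite inE.
by rewrite !nB // !permM permKV gY.
Qed.

Lemma young_coef_lower x : e (x * g * x^-1)%g >=
  (x \in row_placements)%:R -
    \sum_(J in powerset B | J != set0) (x \in contributing J)%:R.
Proof.
have sum_ge0 (P : pred {set 'I_n}) :
    0 <= \sum_(J in powerset B | P J) (x \in contributing J)%:R :> int.
  by apply: sumr_ge0 => J _; case: (_ \in _).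
have [gx|ngx] := boolP (x \in row_placements).
  by rewrite young_coef_row_placement // lerBlDr lerDl sum_ge0.
rewrite sub0r; have [->|ne] := eqVneq (e (x * g * x^-1)%g) 0.
  by rewrite oppr_le0 sum_ge0.
have mP : (met x \in powerset B) && (met x != set0).
  rewrite powersetE; apply/andP; split.
    by apply/subsetP => b; rewrite in_set => /andP[].
  apply: contraNneq ngx => m0; rewrite inE; apply/forall_inP => b Bb.
  by have := in_set0 b; rewrite -m0 in_set Bb /= => ->.
apply: le_trans (young_coef_ge _ _).
rewrite lerNl opprK (bigD1 (met x)) //=.
have -> : x \in contributing (met x) by rewrite in_set eqxx.
rewrite lerDl; under eq_bigl do rewrite -andbA; exact: sum_ge0.
Qed.

(** There are binomial(d, j) sets J with j elements; [card_contributing] and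
    [bin_exp_le] bound the sum by 2^-j times the number of first-row
    placements. *)
Lemma card_contributing_level j : (0 < j)%N ->
  (2 ^ j *
     \sum_(J : {set 'I_n} | (J \subset B) && (#|J| == j)) #|contributing J|
    <= #|row_placements|)%N.
Proof.
move=> j0; have [lejd|ltdj] := leqP j d; last first.
  rewrite big1 ?muln0 // => J /andP[/subset_leq_card le /eqP eJ].
  by rewrite eJ leqNgt ltdj in le.
have M0 : (0 < M)%N.
  by apply: leq_trans le16M; rewrite muln_gt0 (leq_trans j0 lejd).
have C0 : (0 < 'C(d, j))%N by rewrite bin_gt0.
have C0M : (0 < 'C(d, j) * M ^ j)%N by rewrite muln_gt0 C0 expn_gt0 M0.
have cC : #|[set J : {set 'I_n} | (J \subset B) && (#|J| == j)]| = 'C(d, j).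
  exact: cards_draws.
set S := (\sum_(J | _) _)%N.
have leS : (M ^ j * S <= 'C(d, j) * ((2 * j) ^ j * #|row_placements|))%N.
  rewrite -cC -sum_nat_const big_distrr /=.
  rewrite [X in (_ <= X)%N](eq_bigl _ _ (in_set _)).
  apply: leq_sum => J /andP[sJ /eqP cJ].
  by rewrite mulnC -cJ; apply: card_contributing.
rewrite -(leq_pmul2l C0M).
move: leS (bin_exp_le j le16M).
move: 'C(d, j) (M ^ j)%N #|row_placements| => c m G leS le.
have -> : (c * m * (2 ^ j * S) = c * 2 ^ j * (m * S))%N by ring.
apply: leq_trans (leq_mul (leqnn _) leS) _.
have -> : (c * 2 ^ j * (c * ((2 * j) ^ j * G)) =
  c * (2 ^ j * (2 * j) ^ j) * (c * G))%N by ring.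
have -> : (c * m * G = m * (c * G))%N by ring.
by rewrite leq_mul2r le orbT.
Qed.

(** The sum of 2^-j over 1 <= j <= d is 1 - 2^-d. *)
Lemma sum_contributing :
  (2 ^ d * \sum_(J in powerset B | J != set0) #|contributing J| <=
  (2 ^ d - 1) * #|row_placements|)%N.
Proof.
pose f (J : {set 'I_n}) : 'I_d.+1 := inord #|J|.
have fE (J : {set 'I_n}) : J \subset B -> f J = #|J| :> nat.
  by move=> sJ; rewrite inordK // ltnS subset_leq_card.
rewrite (partition_big f (fun j => j != ord0)) /=; last first.
  move=> J; rewrite powersetE => /andP[sJ nJ].
  by rewrite -val_eqE [val _]fE // cards_eq0.
rewrite big_mkcond big_ord_recl /= add0n big_distrr /=.
have -> : (2 ^ d - 1 = \sum_(j < d) 2 ^ (d - j.+1))%N.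
  rewrite subn1 predn_exp mul1n (reindex_inj rev_ord_inj) /=.
  by apply: eq_bigr => j _.
rewrite big_distrl /=; apply: leq_sum => j _.
have -> : (2 ^ d = 2 ^ (d - j.+1) * 2 ^ j.+1)%N by rewrite -expnD subnK.
rewrite -mulnA leq_mul2l; apply/orP; right.
apply: leq_trans (card_contributing_level (ltn0Sn j)).
rewrite leq_mul2l; apply/orP; right.
rewrite leq_eqVlt; apply/orP; left; apply/eqP; apply: eq_bigl => J.
rewrite powersetE; case sJ: (J \subset B) => //=.
by rewrite -[f J == _]val_eqE [val (f J)]fE // -cards_eq0 /bump; case: #|J|.
Qed.

Lemma young_sum_lower :
  ((M ^ d * n`!)%N)%:R <=
    (\sum_(x : 'S_n) e (x * g * x^-1)%g) * ((2 * n) ^ d)%:R.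
Proof.
set S := \sum_x _; set G := #|row_placements|.
set b := (\sum_(J in powerset B | J != set0) #|contributing J|)%N.
have leS : G%:R - b%:R <= S.
  have -> : G%:R - b%:R = \sum_(x : 'S_n) ((x \in row_placements)%:R -
      \sum_(J in powerset B | J != set0) (x \in contributing J)%:R) :> int.
    have cardE (A : {set 'S_n}) : #|A|%:R = \sum_(x : 'S_n) (x \in A)%:R :> int.
      rewrite -sum1_card natr_sum big_mkcond /=.
      by apply: eq_bigr => x _; case: (x \in A).
    rewrite sumrB -cardE exchange_big /= natr_sum.
    by congr (_ - _); apply: eq_bigr => J _; rewrite cardE.
  by apply: ler_sum => x _; apply: young_coef_lower.
have leb := sum_contributing; rewrite -/b -/G in leb.
have leG : G%:R <= S * (2 ^ d)%:R.
  apply: le_trans (ler_wpM2r (ler0n _ _) leS).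
  rewrite mulrBl -!natrM mulnC [(b * _)%N]mulnC lerBrDr -natrD ler_nat.
  apply: leq_trans (leq_add (leqnn G) leb) _.
  by rewrite mulnBl mul1n subnKC // leq_pmull // expn_gt0.
apply: le_trans (_ : (G * n ^ d)%:R <= _).
  by rewrite ler_nat card_row_placements.
by rewrite natrM expnMn natrM mulrA ler_wpM2r.
Qed.
End Placements.

(** * Real estimates *)

Section RealBounds.
Variable R : realType.
Implicit Types eps alpha l D N x y : R.

Lemma powR_neg_le x y a : 0 < x -> x <= y -> a <= 0 -> y `^ a <= x `^ a.
Proof.
move=> x0 lexy a0; rewrite -[a]opprK !(powRN _ (- a)).
rewrite lef_pV2 ?posrE ?powR_gt0 ?(lt_le_trans x0) //.
by rewrite ge0_ler_powR ?nnegrE ?oppr_ge0 // ltW // (lt_le_trans x0).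
Qed.

(** With u = 2D/N <= 1 the claim bounds u ^ (1 + eps - alpha). If alpha <= eps,
    the exponent is at least 1 and 8 D <= l is enough. Otherwise
    D <= c N^eps gives u <= (eps/4)^(1/eps) N^(eps - 1), and
    (1 - eps)(1 + eps - alpha) = 1 - alpha + eps (alpha - eps) >= 1 - alpha;
    c is chosen so that the constant becomes at most eps/4. *)
Lemma powR_base_bound eps alpha l D N (c := (eps / 4) `^ eps^-1 / 2) :
  0 < eps < 1 -> 0 < alpha < 1 -> 1 <= D -> 1 <= N -> 2 * D <= N ->
  alpha * N `^ alpha <= l -> 8 * D <= l -> D <= c * N `^ eps ->
  (N / (2 * D)) `^ (alpha - eps - 1) <= l / (4 * N).
Proof.
move=> /andP[e0 e1] /andP[a0 a1] D1 N1 DN lel Dl Dc.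
have N0 : 0 < N by lra.
have D0 : 0 < 2 * D by lra.
have Nn0 : N != 0 by rewrite gt_eqF.
pose u := 2 * D / N.
have u0 : 0 < u by rewrite divr_gt0.
have u1 : u <= 1 by rewrite ler_pdivrMr // mul1r.
have -> : (N / (2 * D)) `^ (alpha - eps - 1) = u `^ (1 + eps - alpha).
  have -> : N / (2 * D) = u `^ (- 1) by rewrite powR_inv1 ?ltW // /u invf_div.
  by rewrite -powRrM; congr (_ `^ _); ring.
have [ale|alt] := leP alpha eps.
  apply: (@le_trans _ _ u); first by apply: ge1r_powR; rewrite ?u0 //; lra.
  rewrite /u ler_pdivrMr //.
  have -> : l / (4 * N) * N = l / 4 by field.
  lra.
have c2 : u <= (eps / 4) `^ eps^-1 * N `^ (eps - 1).
  rewrite powRB ?Nn0 ?implybT // powRr1 ?(ltW N0) // mulrA /u.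
  rewrite ler_pM2r ?invr_gt0 //.
  by rewrite /c in Dc; lra.
have q0 : 0 <= eps / 4 by lra.
apply: (@le_trans _ _
  (((eps / 4) `^ eps^-1 * N `^ (eps - 1)) `^ (1 + eps - alpha))).
  by rewrite ge0_ler_powR ?nnegrE ?(ltW u0) ?mulr_ge0 ?powR_ge0 //; lra.
rewrite powRM ?powR_ge0 // -!powRrM.
apply: (@le_trans _ _ ((eps / 4) * N `^ (alpha - 1))).
  apply: ler_pM; rewrite ?powR_ge0 //.
    apply: ge1r_powR; first lra.
    by rewrite ler_pdivlMl // mulr1; lra.
  apply: ler_powR; first exact: N1.
  have : 0 < eps * (alpha - eps) by rewrite mulr_gt0 // subr_gt0.
  lra.
rewrite powRB ?Nn0 ?implybT // powRr1 ?(ltW N0) //.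
rewrite ler_pdivlMr ?mulr_gt0 //.
have -> : eps / 4 * (N `^ alpha / N) * (4 * N) = eps * N `^ alpha by field.
by apply: le_trans lel; rewrite ler_wpM2r ?powR_ge0 // ltW.
Qed.

End RealBounds.

(** The upper bound on alpha says that n^alpha < n / ln n, which is below n / 2
    as soon as ln n > 2. *)
Lemma ceil_cycle_count (R : realType) (n : nat) (alpha : R) :
  expR 2 < n%:R :> R -> 0 < alpha < 1 - ln (ln n%:R) / ln n%:R ->
  alpha < 1 /\ exists l : nat, [/\ Num.ceil (alpha * n%:R `^ alpha) = l%:Z,
    (0 < l)%N & (2 * l <= n + 2)%N].
Proof.
move=> gtn /andP[a0 lta].
have n0 : 0 < n%:R :> R by apply: lt_trans gtn; apply: expR_gt0.
have ln2 : 2 < ln n%:R :> R by rewrite -[ltLHS]expRK ltr_ln ?posrE ?expR_gt0.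
have lnln0 : 0 < ln (ln n%:R) :> R by rewrite ln_gt0 //; lra.
have ln0 : 0 < ln n%:R :> R by lra.
have a1 : alpha < 1.
  by apply: lt_trans lta _; rewrite ltrBlDr ltrDl divr_gt0.
split=> //.
have ltp : n%:R `^ alpha < n%:R / ln n%:R.
  rewrite /powR gt_eqF // -[ltRHS]lnK ?posrE ?divr_gt0 //.
  rewrite ltr_expR ln_div ?posrE //.
  by move: lta; rewrite -(ltr_pM2r ln0) mulrBl mul1r divfK // gt_eqF.
have p0 : 0 < n%:R `^ alpha :> R by apply: powR_gt0.
set v := alpha * _; have v0 : 0 < v by rewrite mulr_gt0.
have c0 : 0 < Num.ceil v by rewrite ceil_gt0.
exists `|Num.ceil v|%N; split.
- by rewrite gez0_abs // ltW.
- by rewrite absz_gt0 gt_eqF.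
rewrite -(ler_nat R) natrM natrD natr_absz gtr0_norm //.
have ltc : (Num.ceil v)%:~R < v + 1.
  by rewrite -ltrBlDr -[1]/(1%:~R) -intrB ceilB1_lt.
have ltv : v < n%:R / 2.
  apply: lt_le_trans (_ : n%:R / ln n%:R <= _).
    by apply: le_lt_trans ltp; rewrite ler_piMl // ltW.
  by rewrite ler_pM2l // lef_pV2 ?posrE // ltW.
lra.
Qed.

Local Open Scope complex_scope.

Theorem theorem1p9 (R : realType) (eps : R) (heps : 0 < eps < 1) :
  exists (n0 : nat) (c : R), 0 < c /\
    forall n : nat, (n0 < n)%N ->
    forall alpha : R, 0 < alpha < 1 - ln (ln n%:R) / ln n%:R ->
    let l : int := Num.ceil (alpha * n%:R `^ alpha) in
    exists s : 'S_n, #|porbits s|%:Z = l /\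
      forall d : nat, d%:R < Num.min (l%:~R / 200%:R) (c * n%:R `^ eps) ->
      forall la : seq nat, is_partition n la -> (head 0 la + d)%N = n ->
        ((complex.Re (chi R la (1%g : 'S_n))) `^ (alpha - eps - 1))%:C
          <= `|chi R la s / chi R la (1%g : 'S_n)|.
Proof.
have [e0 e1] := andP heps.
exists (Num.bound (expR 2 : R)), ((eps / 4) `^ eps^-1 / 2); split.
  by rewrite divr_gt0 ?powR_gt0 ?divr_gt0.
move=> n ltn alpha halpha l.
have gtn : expR 2 < n%:R :> R.
  apply: lt_trans (_ : _ < (Num.bound (expR 2 : R))%:R) _; last first.
    by rewrite ltr_nat.
  by apply: archi_boundP; rewrite expR_ge0.
have [a1 [L [eL L0 leL]]] := ceil_cycle_count gtn halpha.
have [a0 _] := andP halpha.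
have n1 : 1 < n%:R :> R by apply: lt_trans gtn; rewrite expR_gt1.
have n2 : (1 < n)%N by rewrite ltr1n in n1.
have lem : (0 < (n - L).+1 <= n)%N by clear -L0 n2; lia.
have [g [Y [cY cg gY g_out g_trans]]] := exists_cycle lem.
exists (g^-1)%g; split.
  by rewrite porbitsV cg /l eL; congr Posz; clear -L0 leL n2; lia.
move=> d; rewrite lt_min => /andP[ltd1 ltd2] la la_part hd.
have la_n : sumn la = n by case/and3P: la_part => _ _ /eqP.
have cB : #|below n la| = d.
  by have := card_below la_n; clear -hd; lia.
have ltd : (200 * d < L)%N.
  move: ltd1; rewrite /l eL ltr_pdivlMr // => h.
  by rewrite -(ltr_nat R) natrM mulrC.
have [r chi1 ler] := degree_lower_bound R n la.
rewrite cB in ler.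
have ltdY : (#|below n la| < #|Y|)%N.
  by rewrite cB cY; clear -ltd leL; lia.
have le16 : (16 * #|below n la| <= n - #|Y| - #|below n la|)%N.
  by rewrite cB cY; clear -ltd leL n2; lia.
have := young_sum_lower gY g_out g_trans ltdY le16.
rewrite (chi_ratio R la_n) invgK chi1 cB cY.
set S := \sum_x _; set M := (n - _ - _)%N => leS.
have -> : complex.Re (r%:R : R[i]) = r%:R.
  by rewrite -(rmorph_nat (real_complex R)).
have -> : S%:~R / n`!%:R = (S%:~R / n`!%:R : R)%:C.
  rewrite -(rmorph_int (real_complex R)) -(rmorph_nat (real_complex R)).
  by rewrite -fmorphV -rmorphM.
rewrite normc_def /= expr0n /= addr0 sqrtr_sqr lecR.
apply: le_trans (ler_norm _).
have f0 : 0 < n`!%:R :> R by rewrite ltr0n fact_gt0.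
(* The sum is moved from the integers to R: the normalized character is at
   least (M / 2n)^d. *)
have leSR : (M%:R / (2 * n%:R)) ^+ d <= S%:~R / n`!%:R :> R.
  rewrite expr_div_n ler_pdivlMr // mulrAC.
  rewrite ler_pdivrMr ?exprn_gt0 ?mulr_gt0 //; last by clear -n1; lra.
  by move: leS; rewrite -(ler_int R) intrM !natz -!pmulrn natrM !natrX natrM.
apply: le_trans leSR.
have exp0 : alpha - eps - 1 <= 0 by clear -a1 e0; lra.
(* For d = 0 the bases below are meaningless (n / 0), but chi(1) >= 1 and the
   normalized character is at least 1. *)
case: (posnP d) => [d0|dpos].
  apply: (@le_trans _ _ (1 `^ (alpha - eps - 1))).
    2: by rewrite powR1 d0 expr0.
  apply: powR_neg_le => //; rewrite ler1n; apply: leq_trans ler.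
  by rewrite d0 bin0.
have d1 : 1 <= d%:R :> R by rewrite ler1n.
have n4d : (4 * d <= n)%N by clear -ltd leL dpos; lia.
have q0 : 0 < n%:R / (2 * d%:R) :> R.
  by rewrite divr_gt0 ?mulr_gt0 //; clear -n1 d1; lra.
apply: (@le_trans _ _ (((n%:R / (2 * d%:R)) ^+ d) `^ (alpha - eps - 1))).
  apply: powR_neg_le; rewrite ?exprn_gt0 //.
  apply: (@le_trans _ _ 'C(n - d, d)%:R); last by rewrite ler_nat.
  rewrite expr_div_n ler_pdivrMr ?exprn_gt0 ?mulr_gt0 //; last first.
    by clear -n1 d1; lra.
  by have := bin_lower n4d; rewrite -(ler_nat R) natrM !natrX natrM.
rewrite -(powR_mulrn _ (ltW q0)) powRAC powR_mulrn ?powR_ge0 //.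
have b0 : 0 < 2 * n%:R :> R by clear -n1; lra.
rewrite ler_pXn2r ?nnegrE ?powR_ge0 ?divr_ge0 ?(ltW b0) //.
apply: (@le_trans _ _ (L%:R / (4 * n%:R))).
  apply: (powR_base_bound heps); rewrite ?a0 ?(ltW n1) ?(ltW ltd2) //.
  - by rewrite -natrM ler_nat; clear -ltd leL dpos; lia.
  - by rewrite -[L%:R]/(L%:Z%:~R) -eL ceil_ge.
  - by rewrite -natrM ler_nat; clear -ltd leL dpos; lia.
rewrite ler_pdivlMr // mulrAC ler_pdivrMr ?mulr_gt0 //; last first.
  by clear -n1 d1; lra.
(* Here M = L - 1 - d with L > 200 d >= 200. *)
have : (L <= 2 * M)%N by rewrite /M; clear -ltd leL n2 dpos; lia.
rewrite -(ler_nat R) natrM => leLM.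
have -> : L%:R * (2 * n%:R) = L%:R * n%:R * 2 :> R by ring.
have -> : M%:R * (4 * n%:R) = 2 * M%:R * n%:R * 2 :> R by ring.
by rewrite ler_pM2r // ler_pM2r // (lt_trans ltr01 n1).
Qed.
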